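(* Fix $\lambda\in\mathbb R$. There is $M=M(\lambda)<\infty$ such that $$\sup_{n\ge n_\lambda}n^{-2/3}\,\mathbb E\sum_{C\in\mathcal C(G(n,p_n)):\,|C|\ge n^{2/3}}|C|\le M .$$ Consequently, for every $B\ge1$, $$\sup_{n\ge n_\lambda}\mathbb P(X_{n,1}>B)\le M/B .$$
   Context: $p_n=n^{-1}+\lambda n^{-4/3}$, and $n_\lambda$ is a fixed integer such that $p_n\in(0,1)$ for all $n\ge n_\lambda$. $G(n,p)$ is the Erdős–Rényi random graph on $n$ labelled vertices, $\mathcal C(G)$ the set of connected components of $G$, $|C|$ the number of vertices of a component $C$. $X_{n,1}=n^{-2/3}\max_{C\in\mathcal C(G(n,p_n))}|C|$ is the rescaled size of the largest component. *)

(* Defs.v *)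
From mathcomp Require Import all_boot all_order all_algebra.
From mathcomp Require Import all_classical all_reals all_analysis.

Set Implicit Arguments.
Unset Strict Implicit.
Unset Printing Implicit Defensive.

Import Order.TTheory GRing.Theory Num.Theory.
Local Open Scope ring_scope.

(* A simple graph on n labelled vertices is its edge set, a set of unordered
   pairs of distinct vertices; loops are excluded because [set x; x] has
   cardinal 1. *)
Definition edge (n : nat) : finType := {e : {set 'I_n} | #|e| == 2}.

Definition graph (n : nat) : finType := {set edge n}.

Definition adj (n : nat) (G : graph n) : rel 'I_n :=
  fun x y => [exists e in G, val e == [set x; y]].

Definition components (n : nat) (G : graph n) : {set {set 'I_n}} :=
  equivalence_partition (connect (adj G)) [set: 'I_n].

(* The law of G(n, p): the edges are present independently, each with
   probability p. *)
Definition gnp_weight (R : realType) (n : nat) (p : R) (G : graph n) : R :=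
  \prod_(e : edge n) (if e \in G then p else 1 - p).

Definition gnp_expectation (R : realType) (n : nat) (p : R)
    (X : graph n -> R) : R :=
  \sum_(G : graph n) gnp_weight p G * X G.

Definition gnp_prob (R : realType) (n : nat) (p : R) (A : pred (graph n)) : R :=
  \sum_(G : graph n | A G) gnp_weight p G.

Lemma gnp_weight_sum1 (R : realType) (n : nat) (p : R) :
  \sum_(G : graph n) gnp_weight p G = 1.
Proof.
rewrite /gnp_weight -bigA_distr big1// => e _.
by rewrite /= addrC subrK.
Qed.

Definition p_crit (R : realType) (lambda : R) (n : nat) : R :=
  n%:R^-1 + lambda * n%:R `^ (- (4 / 3)).

Definition large_component_mass (R : realType) (n : nat) (G : graph n) : R :=
  \sum_(C in components G | n%:R `^ (2 / 3) <= #|C|%:R :> R) #|C|%:R.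

Definition rescaled_max_component (R : realType) (n : nat) (G : graph n) : R :=
  n%:R `^ (- (2 / 3)) * (\max_(C in components G) #|C|)%:R.

(* Main.v *)
Require Import Defs.
From mathcomp Require Import all_boot all_order all_algebra.
From mathcomp Require Import all_classical all_reals all_analysis.
From mathcomp Require Import ring lra.

(** Why the theorem holds.  The expected mass of the components of size at least
    [n `^ (2/3)] is [n] times the probability that a given vertex [v] lies in one
    of them, so that probability has to be [O(n `^ (-1/3))].

    Let [m = n `^ (-1/3)] and [s = 1 / (1 + m^2)].  Since [s ^+ c <= 1/2] as soon
    as [c >= n `^ (2/3) = m^-2], it suffices that the cluster [C] of [v] satisfies
    [1 - E s^|C| = O(m)] ([expected_mass_le]).  If the cluster were a branching
    process with binomial offspring, [E s^|C|] would solve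
    [g = s (1 - p + p g)^n].  On the graph itself a subsolution is enough: when
    [0 <= g <= 1] and [g <= s (1 - p + p g)^n], the set reached from any set [A]
    of roots has generating function at least [g^|A|] ([reach_generating_ge]).
    This follows by induction on the number of vertices.  Exploring a root [a]
    replaces it by its neighbours, whose number is dominated by a binomial
    variable, and the edges at [a] are independent of the graph that remains
    ([reach_step], [gnp_expectation_decouple]).

    At [p = (1 + lambda m) / n] the choice [g = 1 - K m] with
    [K = 3 (1 + |lambda|)] is a subsolution once [K m <= 1/10]
    ([window_subsolution]): the term of order [m] cancels, and at order [m^2] the
    convexity gain [K^2 / 2] of the binomial generating function dominates the
    killing [1] and the drift [lambda K].  For [K m > 1/10] the bound [n] on the
    mass is good enough.  The tail bound on the largest component is Markov's
    inequality ([max_component_markov]). *)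

Set Implicit Arguments.
Unset Strict Implicit.
Unset Printing Implicit Defensive.

Import Order.TTheory GRing.Theory Num.Theory.
Local Open Scope ring_scope.

(** * Expectations over a product of Bernoulli edges *)

Lemma gnp_weight_ge0 (R : realType) (n : nat) (p : R) (G : graph n) :
  0 <= p <= 1 -> 0 <= gnp_weight p G.
Proof.
move=> /andP[p0 p1]; apply: prodr_ge0 => e _.
by case: ifP => _ //; rewrite subr_ge0.
Qed.

Lemma ler_gnp_expectation (R : realType) (n : nat) (p : R)
    (X Y : graph n -> R) :
  0 <= p <= 1 -> (forall G, X G <= Y G) ->
  gnp_expectation p X <= gnp_expectation p Y.
Proof.
move=> p01 XY; apply: ler_sum => G _.
by apply: ler_wpM2l => //; exact: gnp_weight_ge0.
Qed.

Lemma gnp_expectationZ (R : realType) (n : nat) (p c : R) (X : graph n -> R) :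
  gnp_expectation p (fun G => c * X G) = c * gnp_expectation p X.
Proof. by rewrite /gnp_expectation mulr_sumr; apply: eq_bigr => G _; ring. Qed.

Lemma gnp_expectation_cst (R : realType) (n : nat) (p c : R) :
  gnp_expectation p (fun _ : graph n => c) = c.
Proof. by rewrite /gnp_expectation -mulr_suml gnp_weight_sum1 mul1r. Qed.

Lemma gnp_expectation_sum (R : realType) (n : nat) (p : R) (I : finType)
    (X : I -> graph n -> R) :
  gnp_expectation p (fun G => \sum_i X i G) = \sum_i gnp_expectation p (X i).
Proof.
rewrite /gnp_expectation exchange_big; apply: eq_bigr => G _.
by rewrite mulr_sumr.
Qed.

Lemma gnp_prob_expectation (R : realType) (n : nat) (p : R)
    (A : pred (graph n)) :
  gnp_prob p A = gnp_expectation p (fun G => (A G)%:R).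
Proof.
rewrite /gnp_prob /gnp_expectation big_mkcond; apply: eq_bigr => G _.
by case: (A G); rewrite ?mulr1 ?mulr0.
Qed.

(** Disjoint sets of edges are independent, so the part of the graph outside
    [F] may be resampled: exchanging the parts outside [F] of two independent
    copies is an involution that preserves the product law. *)
Lemma gnp_expectation_decouple (R : realType) (n : nat) (p : R)
    (F : {set edge n}) (H : graph n -> graph n -> R) :
  (forall G G', H G G' = H (G :&: F)%SET (G' :\: F)%SET) ->
  gnp_expectation p (fun G => H G G) =
  gnp_expectation p (fun G => gnp_expectation p (H G)).
Proof.
move=> HF; rewrite /gnp_expectation.
pose sw (u : graph n * graph n) :=
  ((u.1 :&: F) :|: (u.2 :\: F), (u.2 :&: F) :|: (u.1 :\: F))%SET.
have swK : involutive sw.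
  move=> [G G']; congr pair; apply/setP => e; rewrite !inE /=;
  by case: (e \in G); case: (e \in G'); case: (e \in F).
have weight_sw u : gnp_weight p (sw u).1 * gnp_weight p (sw u).2 =
                   gnp_weight p u.1 * gnp_weight p u.2.
  rewrite /gnp_weight -!big_split; apply: eq_bigr => e _ /=.
  by rewrite !inE; case: (e \in F); rewrite !(andbF, andbT, orbF, orFb) //= mulrC.
transitivity (\sum_(u : graph n * graph n)
    gnp_weight p u.1 * gnp_weight p u.2 * H u.1 u.2); last first.
  rewrite -(pair_bigA _ (fun G G' => gnp_weight p G * gnp_weight p G' * H G G')).
  by apply: eq_bigr => G _; rewrite mulr_sumr; apply: eq_bigr => G' _; ring.
rewrite (reindex_inj (inv_inj swK)).
transitivity (\sum_(u : graph n * graph n)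
    gnp_weight p u.1 * gnp_weight p u.2 * H u.1 u.1); last first.
  apply: eq_bigr => u _; rewrite weight_sw; congr (_ * _).
  rewrite HF [RHS]HF; congr H; apply/setP => e; rewrite !inE;
  by case: (e \in u.1); case: (e \in u.2); case: (e \in F).
rewrite -(pair_bigA _ (fun G G' => gnp_weight p G * gnp_weight p G' * H G G)).
apply: eq_bigr => G _.
by rewrite -mulr_suml -mulr_sumr gnp_weight_sum1 mulr1.
Qed.

(** The number of edges present in [F] is binomial. *)
Lemma gnp_expectation_card_edges (R : realType) (n : nat) (p g : R)
    (F : {set edge n}) :
  gnp_expectation p (fun G : graph n => g ^+ #|G :&: F|%SET) =
  (1 - p + p * g) ^+ #|F|.
Proof.
rewrite -prodr_const big_mkcond /=.
under eq_bigr => e _.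
  rewrite (_ : (if _ then _ else _) =
    p * (if e \in F then g else 1) + (1 - p)); last by case: ifP => _; ring.
  over.
rewrite bigA_distr; apply: eq_bigr => G _.
rewrite /gnp_weight -prodr_const [X in _ * X = _]big_mkcond -big_split; apply: eq_bigr => e _ /=.
by rewrite inE; case: (e \in G); case: (e \in F); rewrite ?mulr1.
Qed.

(** * Exploring the graph from a set of vertices *)

Definition restr_adj (n : nat) (G : graph n) (W : {set 'I_n}) : rel 'I_n :=
  fun x y => [&& adj G x y, x \in W & y \in W].

Definition reach (n : nat) (G : graph n) (W A : {set 'I_n}) : {set 'I_n} :=
  [set y | [exists x in A, connect (restr_adj G W) x y]].

Definition star (n : nat) (a : 'I_n) : {set edge n} := [set e : edge n | a \in val e].

Definition nbrs (n : nat) (G : graph n) (a : 'I_n) : {set 'I_n} :=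
  [set y | adj G a y].

Lemma adj_sym (n : nat) (G : graph n) : symmetric (adj G).
Proof.
by move=> x y; apply: eq_existsb => e; rewrite finset.setUC.
Qed.

Lemma adj_irr (n : nat) (G : graph n) : irreflexive (adj G).
Proof.
move=> x; apply/negbTE/negP; rewrite /adj => /existsP[e /andP[_ /eqP eE]].
by have := valP e; rewrite eE finset.setUid cards1.
Qed.

Lemma connect_stable (T : finType) (e : rel T) (S : {set T}) (x y : T) :
  (forall u v, e u v -> u \in S -> v \in S) ->
  connect e x y -> x \in S -> y \in S.
Proof.
move=> Se /connectP[q + ->]; elim: q x => //= z q IH x /andP[exz zq] xS.
exact: IH zq (Se _ _ exz xS).
Qed.

Lemma reach0 (n : nat) (G : graph n) (W : {set 'I_n}) :
  reach G W finset.set0 = finset.set0.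
Proof. by apply/setP => y; rewrite !inE; apply/existsP => -[x]; rewrite inE. Qed.

(** One step of the exploration: the right-hand side contains [A] and is stable
    under adjacency inside [W], because a step that leaves [a] lands in [a]'s
    neighbourhood and any other step avoids [a]. *)
Lemma reach_step (n : nat) (G : graph n) (W A : {set 'I_n}) (a : 'I_n) :
  reach G W A \subset
  (a |: reach G (W :\ a) ((A :\ a) :|: (nbrs G a :&: (W :\ a))))%SET.
Proof.
set A' := (_ :|: _)%SET; apply/fintype.subsetP => y; rewrite inE => /existsP[x /andP[xA]].
move=> xy; apply: (connect_stable _ xy) => [u v|].
  move=> /and3P[uv uW vW]; rewrite in_setU1 [in X in _ -> X]in_setU1.
  have [//|va] := eqVneq v a; have [ua _|ua /=] := eqVneq u a.
    rewrite /= inE; apply/existsP; exists v; rewrite connect0 andbT.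
    by rewrite !inE va vW -ua uv orbT.
  rewrite !inE => /existsP[z /andP[zA' zu]]; apply/existsP; exists z.
  rewrite zA' /=; apply: (connect_trans zu); apply: connect1.
  by rewrite /restr_adj uv !inE ua va uW vW.
rewrite in_setU1; have [//|xa /=] := eqVneq x a.
rewrite inE; apply/existsP; exists x.
by rewrite connect0 !inE xa xA.
Qed.

Lemma nbrs_star (n : nat) (G : graph n) (a : 'I_n) :
  nbrs G a = nbrs (G :&: star a)%SET a.
Proof.
apply/setP => y; rewrite !inE; apply: eq_existsb => e; rewrite !inE.
by case: eqP => [->|]; rewrite ?andbF // !inE eqxx !andbT.
Qed.

Lemma reach_star (n : nat) (G : graph n) (W A : {set 'I_n}) (a : 'I_n) :
  reach G (W :\ a)%SET A = reach (G :\: star a)%SET (W :\ a)%SET A.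
Proof.
apply/setP => y; rewrite !inE; apply: eq_existsb => x; congr (_ && _).
apply: eq_connect => {x y} x y; rewrite /restr_adj !inE.
have [|xa] := eqVneq x a; first by rewrite !andbF.
have [|ya] := eqVneq y a; first by rewrite !andbF.
congr (_ && _); apply: eq_existsb => e; rewrite !inE.
case: eqP => [->|]; rewrite ?andbF // !inE !andbT.
by rewrite [a == x]eq_sym [a == y]eq_sym (negbTE xa) (negbTE ya).
Qed.

Lemma set2_inj (T : finType) (a y z : T) :
  y != a -> [set a; y]%SET = [set a; z]%SET -> y = z.
Proof.
move=> ya /setP/(_ y); rewrite !inE eqxx orbT (negbTE ya) /=.
by move=> /esym/eqP.
Qed.

Lemma card_nbrs (n : nat) (G : graph n) (a : 'I_n) :
  (#|nbrs G a| <= #|G :&: star a|%SET)%N.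
Proof.
rewrite -(card_imset (G :&: star a)%SET val_inj).
rewrite -(card_in_imset (f := fun y => [set a; y]%SET)); last first.
  move=> y z; rewrite inE => ay _; apply: set2_inj.
  by apply: contraTneq ay => ->; rewrite adj_irr.
apply/subset_leq_card/fintype.subsetP => _ /imsetP[y + ->].
rewrite inE /adj => /existsP[e /andP[eG /eqP eE]].
by apply/imsetP; exists e => //; rewrite !inE eG eE !inE eqxx.
Qed.

Lemma card_star (n : nat) (a : 'I_n) : (#|star a| <= n)%N.
Proof.
rewrite -(card_imset (star a) val_inj) -[leqRHS]card_ord.
apply: leq_trans (leq_imset_card (fun y => [set a; y]%SET) _).
apply/subset_leq_card/fintype.subsetP => _ /imsetP[e + ->]; rewrite inE => ae.
have /cards2P[x [y [xy eE]]] := valP e.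
move: ae; rewrite eE !inE => /orP[] /eqP ->; apply/imsetP; [by exists y|].
by exists x; rewrite // finset.setUC.
Qed.

(** Exploring [a] costs a factor [s] and replaces [a] by at most a binomial
    number of new roots, independent of the graph that is left; so a
    subsolution [g] of the equation satisfied by the generating function of the
    total progeny propagates along the exploration. *)
Lemma reach_generating_ge (R : realType) (n : nat) (p s g : R)
    (W A : {set 'I_n}) :
  0 <= p <= 1 -> 0 <= s <= 1 -> 0 <= g <= 1 ->
  g <= s * (1 - p + p * g) ^+ n -> A \subset W ->
  g ^+ #|A| <= gnp_expectation p (fun G => s ^+ #|reach G W A|).
Proof.
move=> p01 /andP[s0 s1] /andP[g0 g1] gs.
have [p0 p1] := andP p01.
have [m mE] : exists m, #|W| = m by exists #|W|.
elim: m W A mE => [|m IH] W A cW sAW.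
  move: sAW; rewrite (cards0_eq cW) finset.subset0 => /eqP ->.
  under [X in gnp_expectation _ X]eq_fun do rewrite reach0.
  by rewrite cards0 expr0 gnp_expectation_cst.
have [->|[a aA]] := set_0Vmem A.
  under [X in gnp_expectation _ X]eq_fun do rewrite reach0.
  by rewrite cards0 expr0 gnp_expectation_cst.
pose H (G G' : graph n) : R :=
  s ^+ #|reach G' (W :\ a) ((A :\ a) :|: (nbrs G a :&: (W :\ a)))|%SET.
have HX : s * gnp_expectation p (fun G => H G G) <=
    gnp_expectation p (fun G => s ^+ #|reach G W A|).
  rewrite -gnp_expectationZ; apply: ler_gnp_expectation => // G.
  rewrite -exprS; apply: ler_wiXn2l => //.
  apply: leq_trans (subset_leq_card (reach_step G W A a)) _.
  by rewrite cardsU1 -add1n leq_add2r leq_b1.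
apply: le_trans HX.
rewrite (@gnp_expectation_decouple _ _ _ (star a) H); last first.
  by move=> G G'; rewrite /H reach_star nbrs_star.
have HA : g ^+ #|A|.-1 * gnp_expectation p (fun G => g ^+ #|G :&: star a|%SET) <=
    gnp_expectation p (fun G => gnp_expectation p (H G)).
  rewrite -gnp_expectationZ; apply: ler_gnp_expectation => // G.
  apply: le_trans (IH (W :\ a)%SET _ _ _).
  - rewrite -exprD; apply: ler_wiXn2l => //.
    apply: leq_trans (leq_card_setU _ _) _; apply: leq_add.
      by rewrite (cardsD1 a A) aA.
    apply: leq_trans (card_nbrs G a).
    by apply: subset_leq_card; rewrite finset.subsetIl.
  - by move: cW; rewrite (cardsD1 a W) (fintype.subsetP sAW _ aA) add1n => -[].
  - by rewrite finset.subUset finset.setSD // finset.subsetIr.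
apply: le_trans (ler_wpM2l s0 HA).
rewrite gnp_expectation_card_edges (cardsD1 a A) aA add1n exprS /=.
rewrite mulrCA [leLHS]mulrC; apply: ler_wpM2l; first exact: exprn_ge0.
apply: (le_trans gs); apply: ler_wpM2l => //; apply: ler_wiXn2l.
- by rewrite addr_ge0 ?mulr_ge0 // subr_ge0.
- by have : p * g <= p * 1 by [rewrite ler_wpM2l]; lra.
- exact: card_star.
Qed.

(** * The expected mass of the large components *)

Lemma connect_adj_equiv (n : nat) (G : graph n) :
  {in [set: 'I_n]%SET & &, equivalence_rel (connect (adj G))}.
Proof.
move=> x y z _ _ _; split=> [|xy]; first exact: connect0.
by apply: (same_connect _ xy); apply/sym_connect_sym/adj_sym.
Qed.

Lemma pblock_components (n : nat) (G : graph n) (v : 'I_n) :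
  finset.pblock (components G) v = reach G [set: 'I_n]%SET [set v]%SET.
Proof.
apply/setP => y.
rewrite pblock_equivalence_partition ?inE //; last exact: connect_adj_equiv.
rewrite (eq_connect (e' := restr_adj G [set: 'I_n]%SET)).
  apply/idP/existsP => [vy|[x]]; first by exists v; rewrite inE eqxx.
  by rewrite inE => /andP[/eqP ->].
by move=> x z; rewrite /restr_adj !inE !andbT.
Qed.

Lemma partition_components (n : nat) (G : graph n) :
  finset.partition (components G) [set: 'I_n]%SET.
Proof. exact/equivalence_partitionP/connect_adj_equiv. Qed.

Lemma large_component_mass_vertices (R : realType) (n : nat) (G : graph n) :
  large_component_mass R G =
  \sum_(v : 'I_n)
    (n%:R `^ (2 / 3) <= #|reach G [set: 'I_n]%SET [set v]%SET|%:R :> R)%:R.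
Proof.
have cP := partition_components G.
transitivity (\sum_(v in [set: 'I_n]%SET)
    (n%:R `^ (2 / 3) <= #|finset.pblock (components G) v|%:R :> R)%:R : R).
  rewrite (set_partition_big _ cP) /= /large_component_mass big_mkcondr /=.
  apply: eq_bigr => C CP; rewrite (eq_bigr (fun _ =>
    (n%:R `^ (2 / 3) <= #|C|%:R :> R)%:R)); last first.
    move=> v vC; have /and3P[_ tI _] := cP.
    by rewrite (def_pblock tI CP vC).
  by rewrite sumr_const; case: ifP => _ //; rewrite mul0rn.
by apply: eq_big => v; rewrite ?inE // => _; rewrite pblock_components.
Qed.

Lemma large_component_mass_le (R : realType) (n : nat) (G : graph n) :
  large_component_mass R G <= n%:R.
Proof.
rewrite large_component_mass_vertices.
apply: (@le_trans _ _ (\sum_(v : 'I_n) 1)); first by apply: ler_sum => v _; rewrite lern1 leq_b1.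
by rewrite sumr_const card_ord.
Qed.

(** Killing each vertex independently with probability [1 - s] kills a given
    component with probability [1 - s ^+ c], at least one half when its size
    [c] is at least [n `^ (2/3)]; and the cluster of a vertex is killed with
    probability at most [1 - g]. *)
Lemma expected_mass_le (R : realType) (n : nat) (p s g : R) :
  0 <= p <= 1 -> 0 <= s <= 1 -> 0 <= g <= 1 ->
  g <= s * (1 - p + p * g) ^+ n ->
  (forall c : nat, n%:R `^ (2 / 3) <= c%:R :> R -> s ^+ c <= 2^-1) ->
  gnp_expectation p (fun G : graph n => large_component_mass R G) <=
  n%:R * (2 * (1 - g)).
Proof.
have dichotomy (b : bool) (t : R) :
    t <= 1 -> (b -> t <= 2^-1) -> b%:R + 2 * t <= 2.
  by case: b => /= t1 h; [have := h isT|]; lra.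
move=> p01 s01 g01 gs sc.
pose X v (G : graph n) : R :=
  (n%:R `^ (2 / 3) <= #|reach G [set: 'I_n]%SET [set v]%SET|%:R :> R)%:R.
have -> : gnp_expectation p (fun G : graph n => large_component_mass R G) =
    \sum_v gnp_expectation p (X v).
  rewrite -gnp_expectation_sum; apply: eq_bigr => G _.
  by rewrite large_component_mass_vertices.
apply: (@le_trans _ _ (\sum_(v : 'I_n) 2 * (1 - g))); last first.
  by rewrite sumr_const card_ord -[leLHS]mulr_natl.
apply: ler_sum => v _.
have := @reach_generating_ge _ _ _ _ _ [set: 'I_n]%SET [set v]%SET p01 s01 g01 gs
  (finset.subsetT _).
rewrite cards1 expr1; set Y := (fun G => s ^+ _) => gY.
have XY : gnp_expectation p (fun G => X v G + 2 * Y G) <=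
    gnp_expectation p (fun _ : graph n => 2).
  apply: ler_gnp_expectation => // G; rewrite /X /Y.
  have [s0 s1] := andP s01.
  by apply: dichotomy => [|/sc //]; exact: exprn_ile1.
rewrite gnp_expectation_cst in XY.
have XYE : gnp_expectation p (X v) + 2 * gnp_expectation p Y =
    gnp_expectation p (fun G => X v G + 2 * Y G).
  rewrite -gnp_expectationZ /gnp_expectation -big_split.
  by apply: eq_bigr => G _; rewrite /= mulrDr.
by rewrite -XYE in XY; lra.
Qed.

(** * The critical window *)

Lemma bonferroni3 (R : realType) (n : nat) (y : R) : 0 <= y <= 1 ->
  1 - n%:R * y + n%:R * (n%:R - 1) / 2 * y ^+ 2
    - n%:R * (n%:R - 1) * (n%:R - 2) / 6 * y ^+ 3 <= (1 - y) ^+ n.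
Proof.
move=> /andP[y0 y1]; elim: n => [|n IH]; first by rewrite expr0; lra.
rewrite [leRHS]exprS; have y1' : 0 <= 1 - y by rewrite subr_ge0.
apply: le_trans (ler_wpM2l y1' IH).
have h : 0 <= n%:R * (n%:R - 1) * (n%:R - 2) / 6 * y ^+ 4 :> R.
  rewrite mulr_ge0 ?exprn_ge0 // divr_ge0 //.
  have [n2|] := leqP 2 n.
    have n2' : 2 <= n%:R :> R by rewrite ler_nat.
    by rewrite !mulr_ge0 //; lra.
  by case: n {IH} => [|[|//]] _; rewrite ?mul0r // subrr mulr0 mul0r.
rewrite -natr1; move: n%:R h => N h.
rewrite -subr_ge0; apply: (le_trans h).
by rewrite le_eqVlt; apply/orP; left; apply/eqP; field.
Qed.

Lemma bernoulli_ge (R : realType) (c : nat) (d : R) :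
  0 <= d -> 1 + c%:R * d <= (1 + d) ^+ c.
Proof.
move=> d0; elim: c => [|c IH]; first by rewrite expr0; lra.
rewrite exprS; apply: le_trans (ler_wpM2l _ IH); last lra.
rewrite -natr1; have : 0 <= c%:R * d * d by rewrite !mulr_ge0.
lra.
Qed.

(** With [x = 3 (1 + |lambda|) m], the gain [(n p x)^2 / 2] of the second-order
    term of [(1 - p x) ^+ n] beats the losses [m^2], [lambda m x] and
    [(n p x)^3 / 6], since [m^2 + |lambda| m x <= x^2 / 3]. *)
Lemma window_subsolution (R : realType) (lambda m p x : R) (n : nat) :
  0 < m -> n%:R * m ^+ 3 = 1 -> n%:R * p = 1 + lambda * m ->
  0 <= p <= 1 -> x = 3 * (1 + `|lambda|) * m -> x <= 10^-1 ->
  (1 + m ^+ 2) * (1 - x) <= (1 - p * x) ^+ n.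
Proof.
move=> m0 nm np /andP[p0 p1] xE x1.
have l0 : 0 <= `|lambda| * m by rewrite mulr_ge0 // ltW.
have xl : m + `|lambda| * m = x / 3 by rewrite xE; field.
have /andP[lm1 lm2] : - (`|lambda| * m) <= lambda * m <= `|lambda| * m.
  by rewrite -ler_norml normrM (gtr0_norm m0).
have x0 : 0 <= x by lra.
have y01 : 0 <= p * x <= 1 by rewrite mulr_ge0 // mulr_ile1 //; lra.
apply: le_trans (bonferroni3 n y01).
set q := 1 + lambda * m in np.
have /andP[q1 q2] : 29 / 30 <= q <= 31 / 30 by apply/andP; rewrite /q; lra.
have e1 : n%:R * (n%:R - 1) = (1 - m ^+ 3) * n%:R ^+ 2.
  by rewrite mulrBl mul1r expr2 [m ^+ 3 * _]mulrCA [m ^+ 3 * _]mulrC nm; ring.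
have e2 : n%:R - 2 = (1 - 2 * m ^+ 3) * n%:R.
  by rewrite mulrBl mul1r -mulrA [m ^+ 3 * _]mulrC nm mulr1.
have -> : n%:R * (p * x) = q * x by rewrite mulrA np.
have -> : n%:R * (n%:R - 1) / 2 * (p * x) ^+ 2 =
    (1 - m ^+ 3) / 2 * (q * x) ^+ 2 by rewrite e1 -np; field.
have -> : n%:R * (n%:R - 1) * (n%:R - 2) / 6 * (p * x) ^+ 3 =
    (1 - m ^+ 3) * (1 - 2 * m ^+ 3) / 6 * (q * x) ^+ 3.
  by rewrite e1 e2 -np; field.
have x2 : 0 <= x ^+ 2 by rewrite sqr_ge0.
have m3 : 0 <= m ^+ 3 <= 1 / 1000.
  have m1 : m <= 1 / 10 by lra.
  rewrite exprn_ge0 ?(ltW m0) //= (_ : 1 / 1000 = (1 / 10) ^+ 3); last by field.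
  by rewrite lerXn2r // nnegrE; lra.
have t1 : (1 - m ^+ 3) * (1 - 2 * m ^+ 3) / 6 * (q * x) ^+ 3 <= x ^+ 2 / 50.
  have qx : (q * x) ^+ 3 <= x ^+ 2 / 9.
    have q3 : q ^+ 3 <= (31 / 30) ^+ 3 by rewrite lerXn2r // nnegrE; lra.
    have xx : x ^+ 3 <= x ^+ 2 / 10.
      by rewrite exprSr ler_wpM2l ?sqr_ge0.
    rewrite exprMn; apply: (le_trans (ler_pM _ _ q3 xx)); rewrite ?exprn_ge0 //; lra.
  have qx0 : 0 <= (q * x) ^+ 3 by rewrite exprn_ge0 // mulr_ge0 //; lra.
  have c1 : (1 - m ^+ 3) * (1 - 2 * m ^+ 3) / 6 <= 1 / 6.
    by rewrite ler_pM2r ?mulr_ile1 //; lra.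
  apply: (le_trans (ler_pM _ qx0 c1 qx)); last lra.
  by rewrite divr_ge0 // mulr_ge0 //; lra.
have t2 : 99 / 100 * (93 / 100) / 2 * x ^+ 2 <= (1 - m ^+ 3) / 2 * (q * x) ^+ 2.
  have q2' : 93 / 100 <= q ^+ 2.
    by apply: (@le_trans _ _ ((29 / 30) ^+ 2)); [lra | rewrite lerXn2r // nnegrE; lra].
  rewrite exprMn [leRHS]mulrA ler_wpM2r ?sqr_ge0 // mulrAC ler_pM //; lra.
have t3 : m ^+ 2 + lambda * m * x <= x ^+ 2 / 3.
  have : lambda * m * x <= `|lambda| * m * x by rewrite ler_wpM2r.
  have : m ^+ 2 <= m * x.
    by rewrite expr2 ler_pM2l //; lra.
  have -> : x ^+ 2 / 3 = m * x + `|lambda| * m * x by rewrite -mulrDl xl; field.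
  lra.
have t4 : 0 <= m ^+ 2 * x by rewrite mulr_ge0 ?sqr_ge0.
have t6 : q * x = x + lambda * m * x by rewrite /q; ring.
move: t1 t2; set T3 := _ * (q * x) ^+ 3; set T2 := _ * (q * x) ^+ 2.
move: T3 T2 => T3 T2 t1 t2; rewrite t6; lra.
Qed.

Lemma p_crit_gt0 (R : realType) (lambda : R) (n : nat) :
  0 < p_crit lambda n -> (0 < n)%N.
Proof.
case: n => [|//].
by rewrite /p_crit powR0 ?mulr0 ?invr0 ?addr0 ?ltxx.
Qed.

(** With [m = n `^ (-1/3)], [s = 1 / (1 + m^2)] and [g = 1 - K m], a given
    vertex lies in a large component with probability at most [2 K m], and there
    are [n = m^-3] vertices. *)
Lemma expected_mass_window (R : realType) (lambda : R) (n : nat) :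
  0 < p_crit lambda n < 1 ->
  n%:R `^ (- (2 / 3)) * gnp_expectation (p_crit lambda n)
    (fun G : graph n => large_component_mass R G) <= 30 * (1 + `|lambda|).
Proof.
move=> /andP[p0 p1]; have n0 := p_crit_gt0 p0.
have N0 : 0 < n%:R :> R by rewrite ltr0n.
pose m := n%:R `^ (- (1 / 3)) : R; pose K := 3 * (1 + `|lambda|).
have m0 : 0 < m by exact: powR_gt0.
have powm (j : nat) : n%:R `^ (- (j%:R / 3)) = m ^+ j.
  by rewrite -powR_mulrn ?ltW // -powRrM; congr (_ `^ _); field.
have m3 : n%:R * m ^+ 3 = 1.
  rewrite -powm divff ?pnatr_eq0 // powR_inv1 ?ltW // divff //.
  by rewrite gt_eqF.
have -> : n%:R `^ (- (2 / 3)) = m ^+ 2 by rewrite -powm.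
have kE : n%:R `^ (2 / 3) = (m ^+ 2)^-1 :> R by rewrite -powm -powRN opprK.
have pE : n%:R * p_crit lambda n = 1 + lambda * m.
  rewrite /p_crit (powm 4) mulrDr divff ?gt_eqF //.
  by rewrite exprS mulrCA [n%:R * _]mulrCA m3 mulr1.
have K0 : 0 < K by rewrite mulr_gt0 // ltr_pwDl.
have p01 : 0 <= p_crit lambda n <= 1 by rewrite !ltW.
set E := gnp_expectation _ _.
have -> : 30 * (1 + `|lambda|) = 10 * K by rewrite /K; ring.
have mN j : m ^+ 2 * (n%:R * (j * m)) = j by rewrite -[RHS]mul1r -[in RHS]m3; ring.
(* When [K * m > 1/10] the trivial bound [E <= n] already gives [10 * K]. *)
have [x1|x1] := lerP (K * m) 10^-1; last first.
  have EN : E <= n%:R.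
    rewrite -(gnp_expectation_cst n (p_crit lambda n) n%:R).
    by apply: ler_gnp_expectation => // G; exact: large_component_mass_le.
  rewrite -[leRHS]mN; apply: ler_wpM2l; first by rewrite sqr_ge0.
  by apply: (le_trans EN); rewrite ler_peMr //; lra.
have Km0 : 0 < K * m by exact: mulr_gt0.
have d0 : 0 < 1 + m ^+ 2 by rewrite ltr_pwDl // sqr_ge0.
have sub := window_subsolution m0 m3 pE p01 erefl x1.
have EK : E <= n%:R * (2 * (1 - (1 - K * m))).
  apply: (@expected_mass_le _ _ _ (1 + m ^+ 2)^-1) => //.
  - by rewrite invr_ge0 ltW //= invf_le1 // lerDl sqr_ge0.
  - by apply/andP; lra.
  - rewrite ler_pdivlMl //.
    rewrite (_ : 1 - p_crit lambda n + _ = 1 - p_crit lambda n * (K * m)) //.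
    by ring.
  move=> c; rewrite kE -[(m ^+ 2)^-1]mul1r ler_pdivrMr ?exprn_gt0 // => c1.
  rewrite exprVn lef_pV2 ?posrE ?exprn_gt0 //.
  by apply: le_trans (bernoulli_ge c (sqr_ge0 m)); lra.
apply: (@le_trans _ _ (m ^+ 2 * (n%:R * (2 * K * m)))).
  apply: ler_wpM2l; first by rewrite sqr_ge0.
  by apply: (le_trans EK); rewrite ler_pM2l //; lra.
by rewrite mN; lra.
Qed.

(** As [B >= 1], a component of size above [B n `^ (2/3)] is itself one of the
    large components, so its size is part of their mass. *)
Lemma max_component_markov (R : realType) (n : nat) (B : R) (G : graph n) :
  (0 < n)%N -> 1 <= B ->
  (B < rescaled_max_component R G)%R%:R <=
  B^-1 * (n%:R `^ (- (2 / 3)) * large_component_mass R G).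
Proof.
move=> n0 B1; have N0 : 0 < n%:R `^ (2 / 3) :> R by rewrite powR_gt0 ?ltr0n.
have B0 : 0 < B by exact: lt_le_trans B1.
have mass0 (P : pred {set 'I_n}) :
    0 <= \sum_(C in components G | P C) #|C|%:R :> R by apply: sumr_ge0.
have [BX|_] := boolP (B < _); last first.
  by rewrite !mulr_ge0 ?invr_ge0 ?powR_ge0 ?(ltW B0) //; exact: mass0.
rewrite mulrC ler_pdivlMr // mul1r.
apply: le_trans (ltW BX) _; apply: ler_wpM2l; first exact: powR_ge0.
move: BX; rewrite /rescaled_max_component powRN ltr_pdivlMl //.
have [|C CG ->] := @eq_bigmax_cond _ (mem (components G)) (fun C => #|C|).
  rewrite card_gt0; apply/set0Pn; exists (finset.pblock (components G) (Ordinal n0)).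
  by rewrite pblock_mem // (cover_partition (partition_components G)) inE.
move=> BC; rewrite /large_component_mass (bigD1 C) /=.
  rewrite lerDl; apply: sumr_ge0 => //.
by apply/andP; split=> //; apply: le_trans (ltW BC); rewrite ler_peMr // ltW.
Qed.

Local Open Scope classical_set_scope.
Local Open Scope ring_scope.

Theorem proposition4p4 (R : realType) (lambda : R) (n_lambda : nat)
    (hp : forall n : nat, (n_lambda <= n)%N -> 0 < p_crit lambda n < 1) :
  exists M : R,
    (ereal_sup
       [set (n%:R `^ (- (2 / 3)) *
             gnp_expectation (p_crit lambda n)
               (fun G : graph n => large_component_mass R G))%:E
       | n in [set n : nat | (n_lambda <= n)%N]] <= M%:E)%E /\
    forall B : R, 1 <= B ->
      (ereal_sup
         [set (gnp_prob (p_crit lambda n)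
                 (fun G : graph n => B < rescaled_max_component R G))%:E
         | n in [set n : nat | (n_lambda <= n)%N]] <= (M / B)%:E)%E.
Proof.
have pn n : (n_lambda <= n)%N -> 0 <= p_crit lambda n <= 1.
  by move=> /hp/andP[p0 p1]; rewrite !ltW.
exists (30 * (1 + `|lambda|)); split=> [|B B1].
  apply: ge_ereal_sup => _ [n /= nl <-].
  by rewrite lee_fin; exact: expected_mass_window (hp n nl).
apply: ge_ereal_sup => _ [n /= nl <-]; rewrite lee_fin.
have /andP[/p_crit_gt0 n0 _] := hp n nl.
rewrite gnp_prob_expectation mulrC.
apply: le_trans (ler_gnp_expectation (pn n nl)
  (fun G => max_component_markov G n0 B1)) _.
rewrite !gnp_expectationZ; apply: ler_wpM2l.
  by rewrite invr_ge0; lra.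
exact: expected_mass_window (hp n nl).
Qed.
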